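(* Let $\gamma:I\to G_3^1$ be a Frenet curve of osculating order $3$ in the equiform geometry of the pseudo-Galilean space $G_3^1$, with equiform curvature $\mathcal{K}$ and equiform torsion $\mathcal{T}$. Then $\gamma$ is of type equiform AW$(1)$ if and only if $$-\mathcal{K}'+2\mathcal{K}^2+\mathcal{T}^2=0\quad\text{and}\quad 3\mathcal{K}\mathcal{T}-\mathcal{T}'=0,$$ where $'$ on $\mathcal{K},\mathcal{T}$ denotes the derivative with respect to the equiform parameter $\sigma$.
   Context: Curves. $G_3^1$ is the pseudo-Galilean space, with underlying set $\mathbb{R}^3$. Curves are sufficiently smooth admissible curves (no inflection points, no isotropic tangents, no lightlike principal normals), parametrized by arc length $s=x$: $\gamma(s)=(s,y(s),z(s))$ with $y''(s)\neq\pm z''(s)$ for all $s$ in an interval $I$. The curvature and torsion are $\kappa=\sqrt{|y''^2-z''^2|}>0$ and $\tau=(y''z'''-y'''z'')/\kappa^2$. The trihedron is $\mathbf{e}_1=(1,y',z')$, $\mathbf{e}_2=\frac1\kappa(0,y'',z'')$, $\mathbf{e}_3=\frac1\kappa(0,\epsilon z'',\epsilon y'')$, where $\epsilon=\pm1$ satisfies $|y''^2-z''^2|=\epsilon(y''^2-z''^2)$. It satisfies $\mathbf{e}_1'=\kappa\mathbf{e}_2$, $\mathbf{e}_2'=\tau\mathbf{e}_3$, $\mathbf{e}_3'=\tau\mathbf{e}_2$. Equiform geometry. Let $\rho=1/\kappa$. The equiform parameter is $\sigma=\int\kappa\,ds$. The equiform frame is $\mathbf{T}=\rho\mathbf{e}_1$,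 $\mathbf{N}=\rho\mathbf{e}_2$, $\mathbf{B}=\rho\mathbf{e}_3$. The equiform curvature is $\mathcal{K}=d\rho/ds$ and the equiform torsion is $\mathcal{T}=\rho\tau=\tau/\kappa$. Below, $\mathcal{K}'=d\mathcal{K}/d\sigma$ and $\mathcal{T}'=d\mathcal{T}/d\sigma$. Osculating order. A Frenet curve of osculating order $3$ is a curve for which the $s$-derivatives $\gamma',\gamma'',\gamma'''$ are linearly independent and $\gamma',\gamma'',\gamma''',\gamma''''$ are no longer linearly independent, for all $s\in I$. AW(1) type. Put $Q_3=\frac1{\rho^4}[(2\mathcal{K}^2+\mathcal{T}^2-\mathcal{K}')\mathbf{N}+(\mathcal{T}'-3\mathcal{K}\mathcal{T})\mathbf{B}]$, which equals $\gamma''''(s)$. A Frenet curve of osculating order $3$ is of type equiform AW$(1)$ if $Q_3=0$ for all $s\in I$. *)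

(* Defs.v *)
From HB Require Import structures.
From mathcomp Require Import all_boot all_order all_algebra.
From mathcomp Require Import all_classical all_reals all_analysis.

Set Implicit Arguments.
Unset Strict Implicit.
Unset Printing Implicit Defensive.

Import Order.TTheory GRing.Theory Num.Theory.
Import numFieldNormedType.Exports.

Local Open Scope classical_set_scope.
Local Open Scope ring_scope.

(* Analytic derivatives; in ring_scope these notations otherwise denote the
   formal derivatives of polynomials. *)
Local Notation "f ^` ()" := (derive1 f) : ring_scope.
Local Notation "f ^` ( n )" := (derive1n n f) : ring_scope.

Definition vec3 (R : realType) (a b c : R) : 'rV[R]_3 :=
  \row_(i < 3) [:: a; b; c]`_i.

Definition curve (R : realType) (y z : R -> R) (s : R) : 'rV[R]_3 :=
  vec3 s (y s) (z s).

(* [f] is C^4 on a neighbourhood of [s]. When [s] is an endpoint of the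
   parameter interval, [f] stands for a C^4 extension across [s], so that
   two-sided derivatives agree with the one-sided ones. *)
Definition C4_near (R : realType) (f : R -> R) (s : R) : Prop :=
  \forall u \near s, (forall k : nat, (k < 4)%N -> derivable f^`(k) u 1) /\
    {for u, continuous f^`(4)}.

(* A curve (s, y s, z s) has no isotropic tangent; y'' <> +-z'' excludes both
   inflection points and lightlike principal normals. *)
Definition admissible (R : realType) (I : set R) (y z : R -> R) : Prop :=
  forall s, I s -> [/\ C4_near y s, C4_near z s,
    y^`(2) s <> z^`(2) s & y^`(2) s <> - z^`(2) s].

Definition kappa (R : realType) (y z : R -> R) (s : R) : R :=
  Num.sqrt `| y^`(2) s ^+ 2 - z^`(2) s ^+ 2 |.

Definition tau (R : realType) (y z : R -> R) (s : R) : R :=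
  (y^`(2) s * z^`(3) s - y^`(3) s * z^`(2) s) / kappa y z s ^+ 2.

Definition eps (R : realType) (y z : R -> R) (s : R) : R :=
  Num.sg (y^`(2) s ^+ 2 - z^`(2) s ^+ 2).

Definition e2 (R : realType) (y z : R -> R) (s : R) : 'rV[R]_3 :=
  (kappa y z s)^-1 *: vec3 0 (y^`(2) s) (z^`(2) s).

Definition e3 (R : realType) (y z : R -> R) (s : R) : 'rV[R]_3 :=
  (kappa y z s)^-1 *:
    vec3 0 (eps y z s * z^`(2) s) (eps y z s * y^`(2) s).

Definition rho (R : realType) (y z : R -> R) (s : R) : R := (kappa y z s)^-1.

Definition eqN (R : realType) (y z : R -> R) (s : R) : 'rV[R]_3 :=
  rho y z s *: e2 y z s.

Definition eqB (R : realType) (y z : R -> R) (s : R) : 'rV[R]_3 :=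
  rho y z s *: e3 y z s.

Definition eqK (R : realType) (y z : R -> R) (s : R) : R := (rho y z)^`() s.

Definition eqT (R : realType) (y z : R -> R) (s : R) : R :=
  rho y z s * tau y z s.

(* [sigma] is an indefinite integral of [kappa] with respect to [s]; the
   constant of integration is left free. *)
Definition equiform_parameter (R : realType) (I : set R) (y z : R -> R)
    (sigma : R -> R) : Prop :=
  forall s, I s -> \forall u \near s, is_derive u (1 : R) sigma (kappa y z u).

(* df/dsigma for f and sigma given as functions of the parameter s. *)
Definition deriv_wrt (R : realType) (sigma f : R -> R) (s : R) : R :=
  lim ((f u - f s) / (sigma u - sigma s) @[u --> s^']).

Definition Frenet_order3 (R : realType) (I : set R) (y z : R -> R) : Prop :=
  let g := curve y z in
  forall s, I s ->
    free [:: g^`(1) s; g^`(2) s; g^`(3) s] /\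
    ~~ free [:: g^`(1) s; g^`(2) s; g^`(3) s; g^`(4) s].

Definition Q3 (R : realType) (y z sigma : R -> R) (s : R) : 'rV[R]_3 :=
  let K := eqK y z in let T := eqT y z in
  (rho y z s ^+ 4)^-1 *:
    ((2 * K s ^+ 2 + T s ^+ 2 - deriv_wrt sigma K s) *: eqN y z s +
     (deriv_wrt sigma T s - 3 * K s * T s) *: eqB y z s).

Definition equiform_AW1 (R : realType) (I : set R) (y z sigma : R -> R) :
    Prop :=
  forall s, I s -> Q3 y z sigma s = 0.

(* Main.v *)
Require Import Defs.
From HB Require Import structures.
From mathcomp Require Import all_boot all_order all_algebra.
From mathcomp Require Import all_classical all_reals all_analysis.
From mathcomp Require Import ring lra.

Set Implicit Arguments.
Unset Strict Implicit.
Unset Printing Implicit Defensive.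

Import Order.TTheory GRing.Theory Num.Theory.
Import numFieldNormedType.Exports.

Local Open Scope classical_set_scope.
Local Open Scope ring_scope.

(** The argument is pointwise linear algebra. [Q3] is a nonzero multiple of a combination of [eqN]
    and [eqB] whose coefficients are, up to order of terms and sign, the two expressions of the
    theorem. Since y'' and z'' differ and are not opposite, y''^2 - z''^2 is nonzero, and this makes
    [eqN] and [eqB] linearly independent ([eqN_eqB_independent]). Hence [Q3] vanishes exactly when
    both coefficients do. *)

Lemma admissible_disc_neq0 (R : realType) (I : set R) (y z : R -> R) (s : R) :
  admissible I y z -> I s -> derive1n 2 y s ^+ 2 - derive1n 2 z s ^+ 2 != 0.
Proof.
move=> adm Is; have [_ _ /eqP ynz /eqP yNz] := adm s Is.
by rewrite subr_eq0 eqf_sqr negb_or ynz yNz.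
Qed.

Lemma admissible_rho_neq0 (R : realType) (I : set R) (y z : R -> R) (s : R) :
  admissible I y z -> I s -> rho y z s != 0.
Proof.
move=> adm Is; rewrite invr_neq0// sqrtr_eq0 -ltNge normr_gt0.
exact: admissible_disc_neq0 adm Is.
Qed.

Lemma admissible_eps_neq0 (R : realType) (I : set R) (y z : R -> R) (s : R) :
  admissible I y z -> I s -> eps y z s != 0.
Proof. by move=> adm Is; rewrite sgr_eq0 (admissible_disc_neq0 adm Is). Qed.

(** Cramer's rule for the vectors (p, q) and (q, p), whose determinant is p^2 - q^2. *)
Lemma swap_independent (F : fieldType) (p q a b : F) : p ^+ 2 - q ^+ 2 != 0 ->
  a * p + b * q = 0 -> a * q + b * p = 0 -> a = 0 /\ b = 0.
Proof.
move=> D0 E1 E2; split; apply: (mulIf D0); rewrite mul0r.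
- have -> : a * (p ^+ 2 - q ^+ 2) = p * (a * p + b * q) - q * (a * q + b * p).
    by ring.
  by rewrite E1 E2 !mulr0 subr0.
- have -> : b * (p ^+ 2 - q ^+ 2) = p * (a * q + b * p) - q * (a * p + b * q).
    by ring.
  by rewrite E1 E2 !mulr0 subr0.
Qed.

(** Both vectors have first coordinate 0; the remaining ones are rho^2 (y'', z'') and rho^2 eps
    (z'', y''), a swapped pair up to nonzero factors. *)
Lemma eqN_eqB_independent (R : realType) (I : set R) (y z : R -> R) (s a b : R) :
  admissible I y z -> I s ->
  a *: eqN y z s + b *: eqB y z s = 0 -> a = 0 /\ b = 0.
Proof.
move=> adm Is /rowP ab0.
have D0 := admissible_disc_neq0 adm Is.
have e0 := admissible_eps_neq0 adm Is.
have r0 := admissible_rho_neq0 adm Is.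
have E1 := ab0 (inord 1); have E2 := ab0 (inord 2).
move: E1 E2; rewrite /eqN /eqB /e2 /e3 -/(rho y z s) !mxE !inordK//=.
move=> E1 E2.
have r20 : rho y z s ^+ 2 != 0 by rewrite expf_neq0.
have factor (r e p q : R) :
  r ^+ 2 * (a * p + b * e * q) = a * (r * (r * p)) + b * (r * (r * (e * q))).
  by ring.
(* The sign [eps] is absorbed into the second coefficient, and cancelled at the end because it is
   nonzero. *)
have [||-> /eqP] := swap_independent (a := a) (b := b * eps y z s) D0.
- by apply: (mulfI r20); rewrite mulr0 factor; exact: E1.
- by apply: (mulfI r20); rewrite mulr0 factor; exact: E2.
- by rewrite mulf_eq0 (negPf e0) orbF => /eqP.
Qed.

Theorem theorem4p1 (R : realType) (I : set R) (y z sigma : R -> R)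
  (I_itv : is_interval I) (I_nondeg : I° !=set0)
  (adm : admissible I y z)
  (frenet : Frenet_order3 I y z)
  (sigmaP : equiform_parameter I y z sigma) :
  equiform_AW1 I y z sigma <->
  (forall s, I s ->
     - deriv_wrt sigma (eqK y z) s + 2 * eqK y z s ^+ 2 + eqT y z s ^+ 2 = 0
     /\ 3 * eqK y z s * eqT y z s - deriv_wrt sigma (eqT y z) s = 0).
Proof.
split=> [AW1 s Is|KT s Is].
- have /eqP := AW1 s Is; rewrite /Q3 scaler_eq0 invr_eq0 expf_eq0/=.
  rewrite (negPf (admissible_rho_neq0 adm Is))/= => /eqP.
  (* The coefficient of [eqB] is the opposite of the second expression. *)
  by move=> /(eqN_eqB_independent adm Is)[hN hB]; split; lra.
- have [hN hB] := KT s Is; rewrite /Q3.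
  have -> : 2 * eqK y z s ^+ 2 + eqT y z s ^+ 2
      - deriv_wrt sigma (eqK y z) s = 0 by lra.
  have -> : deriv_wrt sigma (eqT y z) s
      - 3 * eqK y z s * eqT y z s = 0 by lra.
  by rewrite !scale0r addr0 scaler0.
Qed.
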